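(* For every $r\in\mathbb{N}$ and every integer $n\ge 2$, there is an entrywise nonnegative $3rn\times 3rn$ real matrix $M$ with $\mathrm{rank}^+(M)\ge 4r$ such that for every set of fewer than $n$ rows of $M$, the submatrix of $M$ consisting of those rows has nonnegative rank at most $3r$.
   Context: For an entrywise nonnegative matrix $N$ of dimension $a\times b$, its nonnegative rank $\mathrm{rank}^+(N)$ is the smallest $k$ such that $N=AW$ with $A$ an entrywise nonnegative $a\times k$ matrix and $W$ an entrywise nonnegative $k\times b$ matrix. *)

(* Defs.v *)
From mathcomp Require Import all_boot all_order all_algebra.
From mathcomp Require Import Rstruct.
From Stdlib Require Import Reals.
Set Implicit Arguments. Unset Strict Implicit. Unset Printing Implicit Defensive.
Import Order.TTheory GRing.Theory Num.Theory.
Local Open Scope ring_scope.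

Definition nonneg_mx (m n : nat) (A : 'M[R]_(m, n)) : Prop :=
  forall i j, 0 <= A i j.

Definition nnfact (a b : nat) (N : 'M[R]_(a, b)) (k : nat) : Prop :=
  exists (A : 'M[R]_(a, k)) (W : 'M[R]_(k, b)),
    nonneg_mx A /\ nonneg_mx W /\ N = A *m W.

Lemma nnfact_exists (a b : nat) (N : 'M[R]_(a, b)) :
  nonneg_mx N -> exists k, nnfact N k.
Proof.
move=> HN; exists b; exists N, 1%:M; split => //; split; last by rewrite mulmx1.
by move=> i j; rewrite mxE; case: (i == j).
Qed.

Definition nnrank (a b : nat) (N : 'M[R]_(a, b)) (k : nat) : Prop :=
  nnfact N k /\ (forall k', nnfact N k' -> leq k k').

Definition rows_submx (m n : nat) (M : 'M[R]_(m, n)) (S : {set 'I_m}) :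
  'M[R]_(#|S|, n) := rowsub (fun i : 'I_#|S| => enum_val i) M.

(* Main.v *)
(** A rank-3 nonnegative matrix whose rows are points of a convex polygon, written
  in slack coordinates, has nonnegative rank at most 3 iff some triangle inside the
  polygon contains all the points.  The polygon is the unit square: a point is
  [(x, y, z, w)] with [x + z = y + w], up to scaling, the coordinates being the
  distances to the left, bottom, right and top sides.

  Pushing vertices outwards, the triangle may be assumed to have its vertices on
  three sides.  Three points near [(0, 1/2)], [(1/2, 0)] and [(1, 1/2)] force these
  to be the left, bottom and right sides, and two further points leave, essentially,
  a one-parameter family of triangles [T(U)] with vertices [(0, 2, U + 3)],
  [(2U, 0, U + 1)] and [(U + 3, U + 1, 0)].  The edge form through the first two
  vertices takes at [(x, y, z)] the value [y U^2 + (x + 3 y - 2 z) U + x], so the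
  point [(2AB, 2, AB + A + B + 3)] is outside [T(U)] exactly for [A < U < B].  Taking
  [n] such points whose intervals cover the parameter range, each interval having a
  private parameter, there is no triangle for all the points, but there is one as soon
  as one of these [n] points is dropped.  A block diagonal sum of [r] copies
  multiplies the nonnegative rank by [r].  For [n = 2] there is no room for the
  five auxiliary points, and the identity matrix works. *)

Require Import Defs.
From mathcomp Require Import all_boot all_order all_algebra.
From mathcomp Require Import Rstruct.
From Stdlib Require Import Reals.
From mathcomp Require Import ring lra zify.
Import Order.TTheory GRing.Theory Num.Theory.

(** * Triangles with vertices on three sides of the unit square *)

Section Triangles.
Local Open Scope ring_scope.
Variable F : realFieldType.
Implicit Types a b c x y z w U A B : F.

(* [(x, y, z)] lies in the triangle with vertices [(0, a, 1)], [(b, 0, 1 - b)] and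
   [(1, c, 0)]: the three edge forms are nonnegative at it. *)
Definition in_tri a b c x y z : Prop :=
  [/\ 0 <= y * (1 - b) - c * (x * (1 - b) - b * z),
      0 <= a * z + c * x - y
    & 0 <= a * x + b * y - a * b * (x + z)].

Lemma scaled_unit u v w : 0 <= u -> 0 <= v -> 0 <= w -> w = u + v ->
  exists2 a, 0 <= a <= 1 & u = w * a /\ v = w * (1 - a).
Proof.
move=> u0 v0 w0 e; have [w00|wn0] := eqVneq w 0.
  by exists 0; [lra | split; rewrite w00; lra].
have wp : 0 < w by rewrite lt_def wn0.
exists (u / w).
  by rewrite divr_ge0 //= ler_pdivrMr // mul1r e lerDl.
by split; [rewrite mulrC divfK | rewrite mulrBr mulr1 mulrCA divff // mulr1 e addrC addKr].
Qed.

(** The vanishing coordinates make the vertices multiples of [(0, a, 1)], [(b, 0, 1 - b)] and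
    [(1, c, 0)]. Each edge form vanishes at two of these and equals [a * (1 - b) + b * c >= 0] at
    the third. *)
Lemma in_tri_param xa ya za wa xb yb zb wb xc yc zc wc :
  xa = 0 -> yb = 0 -> zc = 0 ->
  0 <= ya -> 0 <= za -> 0 <= wa -> 0 <= xb -> 0 <= zb -> 0 <= wb ->
  0 <= xc -> 0 <= yc -> 0 <= wc ->
  xa + za = ya + wa -> xb + zb = yb + wb -> xc + zc = yc + wc ->
  exists a b c, [/\ 0 <= a <= 1, 0 <= b <= 1, 0 <= c <= 1 &
    forall l m k x y z, 0 <= l -> 0 <= m -> 0 <= k ->
      x = l * xa + m * xb + k * xc -> y = l * ya + m * yb + k * yc ->
      z = l * za + m * zb + k * zc -> in_tri a b c x y z].
Proof.
move=> -> -> -> ya0 za0 wa0 xb0 zb0 wb0 xc0 yc0 wc0 ea eb ec.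
have [a ha [-> _]] : exists2 a, 0 <= a <= 1 & ya = za * a /\ wa = za * (1 - a).
  by apply: scaled_unit => //; lra.
have [b hb [-> ->]] : exists2 a, 0 <= a <= 1 & xb = wb * a /\ zb = wb * (1 - a).
  by apply: scaled_unit => //; lra.
have [c hc [-> _]] : exists2 a, 0 <= a <= 1 & yc = xc * a /\ wc = xc * (1 - a).
  by apply: scaled_unit => //; lra.
exists a, b, c; split=> // l m k x y z l0 m0 k0 -> -> ->.
have D0 : 0 <= a * (1 - b) + b * c.
  by apply: addr_ge0; apply: mulr_ge0; lra.
have h1 : 0 <= l * za * (a * (1 - b) + b * c) by rewrite !mulr_ge0.
have h2 : 0 <= m * wb * (a * (1 - b) + b * c) by rewrite !mulr_ge0.
have h3 : 0 <= k * xc * (a * (1 - b) + b * c) by rewrite !mulr_ge0.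
by split; lra.
Qed.

(* In the next three lemmas the points [(2, 9, 18, 11)], [(18, 9, 2, 11)] and
   [(10, 1, 10, 19)] are read with cyclically shifted coordinates; the suffix lists the
   sides carrying the vertices. *)
Lemma no_tri_TLB a b c : 0 <= a <= 1 -> 0 <= b <= 1 -> 0 <= c <= 1 ->
  in_tri a b c 11 2 9 -> in_tri a b c 11 18 9 -> in_tri a b c 19 10 1 -> False.
Proof.
move=> ha hb hc [L1 L2 L3] [R1 R2 R3] [B1 B2 B3].
have ha' : 7/9 <= a by lra.
have hc' : 9/11 <= c by lra.
(* The edge through the first two vertices bounds [b] from above, the edge through the last two
   bounds it from below, and the bounds conflict. *)
have hb1 : b <= 7/10 by nra.
have hb2 : 8/10 <= b by nra.
lra.
Qed.

Lemma no_tri_BRT a b c : 0 <= a <= 1 -> 0 <= b <= 1 -> 0 <= c <= 1 ->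
  in_tri a b c 9 18 11 -> in_tri a b c 9 2 11 -> in_tri a b c 1 10 19 -> False.
Proof.
move=> ha hb hc [L1 L2 L3] [R1 R2 R3] [B1 B2 B3].
have ha' : 9/11 <= a by lra.
have hc' : 7/9 <= c by lra.
have hb1 : b <= 2/10 by nra.
have hb2 : 3/10 <= b by nra.
lra.
Qed.

Lemma no_tri_RTL a b c : 0 <= a <= 1 -> 0 <= b <= 1 -> 0 <= c <= 1 ->
  in_tri a b c 18 11 2 -> in_tri a b c 2 11 18 -> in_tri a b c 10 19 10 -> False.
Proof.
move=> ha hb hc [L1 L2 L3] [R1 R2 R3] [B1 B2 B3].
have ha' : 9/10 <= a by lra.
have hc' : 9/10 <= c by lra.
have hb1 : b <= 3/10 by nra.
have hb2 : 7/10 <= b by nra.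
lra.
Qed.

(** The bounds on [a] place [U = 2 / a - 3] strictly between 1/4 and 3, the range covered by the
    intervals; [b < 3/4] makes the factor [3 - 4 * b] in [tri_LBR_quadratic] positive. *)
Lemma tri_LBR_bounds a b c : 0 <= a <= 1 -> 0 <= b <= 1 -> 0 <= c <= 1 ->
  in_tri a b c 2 9 18 -> in_tri a b c 18 9 2 -> in_tri a b c 10 1 10 ->
  7/18 <= a < 8/13 /\ b < 3/4.
Proof.
move=> ha hb hc [L1 L2 L3] [R1 R2 R3] [B1 B2 B3].
have ha' : 7/18 <= a by lra.
have hc' : 7/18 <= c by lra.
have hb1 : b < 3/4 by nra.
have hb2 : 2/5 <= b by nra.
split=> //; apply/andP; split=> //; nra.
Qed.

(* The points [(1, 1, 1)] and [(3, 1, 1)] force [c >= 1 - a] and then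
   [b >= 2 U / (3 U + 1)], the value of [b] in the family [T(U)]. *)
Lemma tri_LBR_quadratic a b c U A B : 0 <= b -> b < 3/4 -> 0 < a -> c <= 1 ->
  0 < A -> A < U -> U < B -> a * (U + 3) = 2 ->
  in_tri a b c 1 1 1 -> in_tri a b c 3 1 1 ->
  in_tri a b c (2 * A * B) 2 (A * B + A + B + 3) -> False.
Proof.
move=> b0 hb a0 hc A0 AU UB aU [_ Q3 _] [Q2 _ _] [_ _ P].
have U3 : 0 < U + 3 by lra.
have ea : a = 2 / (U + 3) by apply: (canRL (mulfK _)); [rewrite gt_eqF | ].
have hc' : U + 1 <= c * (U + 3) by nra.
have q2 : c * (3 - 4 * b) <= 1 - b by lra.
have hb' : 2 * U <= b * (3 * U + 1).
  have : (U + 1) * (3 - 4 * b) <= (U + 3) * (1 - b).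
    apply: le_trans (_ : c * (U + 3) * (3 - 4 * b) <= _).
      by rewrite ler_wpM2r //; lra.
    by rewrite -mulrA mulrCA ler_wpM2l // ltW.
  by lra.
have P' : 0 <= 4 * A * B - 2 * b * (3 * A * B + A + B - U).
  have -> : 4 * A * B - 2 * b * (3 * A * B + A + B - U) =
    (a * (2 * A * B) + b * 2 - a * b * (2 * A * B + (A * B + A + B + 3))) * (U + 3).
    by rewrite ea; field; rewrite gt_eqF.
  by rewrite mulr_ge0 // ltW.
have AB0 : 0 < A * B by rewrite mulr_gt0 //; lra.
have D : 0 <= 3 * A * B + A + B - U by lra.
(* Multiplying [hb'] by the quantity in [D] and [P'] by [3 * U + 1] eliminates [b], and this
   inequality remains; it fails for [U] strictly between [A] and [B]. *)
have : 0 <= (U - A) * (U - B).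
  have e : (U - A) * (U - B) = (A * B) * (3 * U + 1) - U * (3 * A * B + A + B - U) by ring.
  rewrite e subr_ge0.
  have h1 : 2 * U * (3 * A * B + A + B - U) <= b * (3 * U + 1) * (3 * A * B + A + B - U).
    by rewrite ler_wpM2r.
  have h2 : 2 * b * (3 * A * B + A + B - U) * (3 * U + 1) <= 4 * A * B * (3 * U + 1).
    by rewrite ler_wpM2r //; lra.
  by lra.
by rewrite leNgt pmulr_rlt0 ?subr_gt0 // subr_lt0 UB.
Qed.

Definition vertex U (e : nat) : F * F * F :=
  nth (U + 3, U + 1, 0) [:: (0, 2, U + 3); (2 * U, 0, U + 1)] e.

(* Barycentric coordinates of [v] in [T(U)]; the last one is the edge form through the
   other two vertices, divided by its value at the third. *)
Definition coef U (v : F * F * F) (e : nat) : F :=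
  let: (x, y, z) := v in
  let k := (y * U ^+ 2 + (x + 3 * y - 2 * z) * U + x) / ((U + 1) ^+ 2 * (U + 3)) in
  nth k [:: (y - k * (U + 1)) / 2; (x - k * (U + 3)) / (2 * U)] e.

Definition slack (v : F * F * F) (j : nat) : F :=
  let: (x, y, z) := v in nth 0 [:: x; y; z; x + z - y] j.

Lemma slack_vertex U v j : 0 < U ->
  slack v j = \sum_(e < 3) coef U v e * slack (vertex U e) j.
Proof.
case: v => [[x y] z] U0; rewrite !big_ord_recr big_ord0 /= add0r.
have U1 : U + 1 != 0 by rewrite gt_eqF //; lra.
have U3 : U + 3 != 0 by rewrite gt_eqF //; lra.
have Un : U != 0 by rewrite gt_eqF.
by case: j => [|[|[|[|j]]]] /=; rewrite ?nth_nil; field; rewrite ?U1 ?U3 ?Un.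
Qed.

Lemma vertex_ge0 U e j : 1 <= U -> 0 <= slack (vertex U e) j.
Proof.
move=> hU; rewrite /vertex; case: e => [|[|e]] /=; rewrite ?nth_nil;
by case: j => [|[|[|[|j]]]] /=; rewrite ?nth_nil; lra.
Qed.

(** The three inequalities are the nonnegativity of the third, first and second coefficient, cleared
    of denominators. *)
Lemma coef_ge0 U x y z e : 0 < U -> 0 <= y * U ^+ 2 + (x + 3 * y - 2 * z) * U + x ->
  y * U ^+ 2 + (x + 3 * y - 2 * z) * U + x <= y * ((U + 1) * (U + 3)) ->
  y * U ^+ 2 + (x + 3 * y - 2 * z) * U + x <= x * (U + 1) ^+ 2 ->
  0 <= coef U (x, y, z) e.
Proof.
rewrite /coef; set k0 := _ + x => U0 hk hy hx.
have U1 : 0 < U + 1 by lra.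
have U3 : 0 < U + 3 by lra.
have D : 0 < (U + 1) ^+ 2 * (U + 3) by rewrite mulr_gt0 // exprn_gt0.
have k_ge0 : 0 <= k0 / ((U + 1) ^+ 2 * (U + 3)) by rewrite divr_ge0 // ltW.
case: e => [|[|e]] /=; rewrite ?nth_nil //.
- apply: divr_ge0 => //; rewrite subr_ge0.
  have -> : k0 / ((U + 1) ^+ 2 * (U + 3)) * (U + 1) = k0 / ((U + 1) * (U + 3)).
    by field; rewrite !gt_eqF.
  by rewrite ler_pdivrMr ?mulr_gt0.
- apply: divr_ge0; last by rewrite mulr_ge0 // ltW.
  rewrite subr_ge0.
  have -> : k0 / ((U + 1) ^+ 2 * (U + 3)) * (U + 3) = k0 / (U + 1) ^+ 2.
    by field; rewrite !gt_eqF.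
  by rewrite ler_pdivrMr ?exprn_gt0.
Qed.

Lemma coef_interval_ge0 U A B e : 1 <= U <= 11/10 -> 1/4 <= A <= 3 -> 1 <= B <= 3 ->
  0 <= (U - A) * (U - B) -> 0 <= coef U (2 * A * B, 2, A * B + A + B + 3) e.
Proof.
move=> hU hA hB h.
have e0 : 2 * U ^+ 2 + (2 * A * B + 3 * 2 - 2 * (A * B + A + B + 3)) * U + 2 * A * B
  = 2 * ((U - A) * (U - B)) by ring.
have U0 : 0 < U by lra.
apply: coef_ge0 => //; rewrite e0; first by lra.
  by nra.
have AB0 : 0 <= A * B by rewrite mulr_ge0 //; lra.
(* Half the difference of the two sides of the goal. The range constants give
   [A + B >= 5/4 > 11/10 >= U]. *)
have : 0 <= U * (A * B * (U + 2) + (A + B - U)).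
  apply: mulr_ge0; first exact: ltW.
  by apply: addr_ge0; [apply: mulr_ge0 => // |]; lra.
by lra.
Qed.

End Triangles.

(** * Normal forms and block sums of nonnegative factorizations *)

Section NonnegativeFactorizations.
Local Open Scope ring_scope.

Lemma nnfact_set (T : finType) (S : {set T}) a b (N : 'M[R]_(a, b))
    (A : 'I_a -> T -> R) (W : T -> 'I_b -> R) :
  (forall i t, 0 <= A i t) -> (forall t j, 0 <= W t j) ->
  (forall i j, N i j = \sum_(t in S) A i t * W t j) -> nnfact N #|S|.
Proof.
move=> A0 W0 NE.
exists (\matrix_(i, k) A i (enum_val k)), (\matrix_(k, j) W (enum_val k) j).
split; first by move=> i k; rewrite mxE.
split; first by move=> k j; rewrite mxE.
apply/matrixP=> i j; rewrite NE mxE big_enum_val.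
by apply: eq_bigr => k _; rewrite !mxE.
Qed.

Lemma nnfact_leq a b (N : 'M[R]_(a, b)) k k' :
  (k <= k')%nat -> nnfact N k -> nnfact N k'.
Proof.
move=> /subnKC <- [A [W [A0 [W0 ->]]]]; exists (row_mx A 0), (col_mx W 0).
rewrite mul_row_col mulmx0 addr0; split; last split=> //.
  by move=> i j; rewrite mxE; case: fintype.split => [l|l] //; rewrite mxE.
by move=> i j; rewrite mxE; case: fintype.split => [l|l] //; rewrite mxE.
Qed.

Lemma nnfact_nrows a b (N : 'M[R]_(a, b)) : nonneg_mx N -> nnfact N a.
Proof.
move=> N0; exists 1%:M, N; split; last by rewrite mul1mx.
by move=> i j; rewrite mxE; case: eqP.
Qed.

(* A rank-one nonnegative term meeting the diagonal block [b] in both factors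
   cannot meet another one, as the off-diagonal entries vanish. *)
Lemma nnfact_blocks a c p q r k d (M : 'M[R]_(a, c)) (N : 'M[R]_(p, q))
    (f : 'I_r -> 'I_p -> 'I_a) (g : 'I_r -> 'I_q -> 'I_c) :
  (forall b b' i j, M (f b i) (g b' j) = if b == b' then N i j else 0) ->
  (forall k', nnfact N k' -> (d <= k')%nat) -> nnfact M k -> (d * r <= k)%nat.
Proof.
move=> ME Nd [A [W [A0 [W0 MAW]]]].
pose S b := [set l : 'I_k | [exists i, A (f b i) l != 0]
                         && [exists j, W l (g b j) != 0]].
have dS b : (d <= #|S b|)%nat.
  apply: Nd; apply: (@nnfact_set _ _ _ _ _ (fun i l => A (f b i) l)
                                         (fun l j => W l (g b j))) => // i j.
  have := ME b b i j; rewrite eqxx => <-; rewrite MAW mxE [RHS]big_mkcond /=.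
  apply: eq_bigr => l _; rewrite inE; case: ifP => // /negbT.
  rewrite negb_and !negb_exists => /orP[] /forallP.
    by move=> /(_ i); rewrite negbK => /eqP->; rewrite mul0r.
  by move=> /(_ j); rewrite negbK => /eqP->; rewrite mulr0.
have disjS b b' l : l \in S b -> l \in S b' -> b = b'.
  rewrite !inE => /andP[/existsP[i Ai] _] /andP[_ /existsP[j Wj]].
  apply/eqP; apply: contraT => nbb.
  have /eqP := ME b b' i j; rewrite (negPf nbb) MAW mxE psumr_eq0; last first.
    by move=> t _; rewrite mulr_ge0.
  by move=> /allP/(_ l); rewrite mem_index_enum mulf_eq0 (negPf Ai) (negPf Wj) => /(_ isT).
have -> : (d * r)%nat = (\sum_(b < r) d)%nat by rewrite sum_nat_const card_ord mulnC.
apply: leq_trans (_ : \sum_(b < r) #|S b| <= k)%nat; first exact: leq_sum.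
rewrite -[k in leqRHS]card_ord -sum1_card.
have cS b : #|S b| = (\sum_(l < k) (l \in S b))%nat.
  by rewrite -sum1_card big_mkcond; apply: eq_bigr => l _; case: ifP.
rewrite (eq_bigr _ (fun b _ => cS b)) exchange_big /=; apply: leq_sum => l _.
have [/existsP[b lb]|/existsPn nl] := boolP [exists b, l \in S b].
  rewrite (bigD1 b) //= lb big1 // => b' nb; case: (boolP (l \in S b')) => // lb'.
  by rewrite (disjS _ _ _ lb lb') eqxx in nb.
by rewrite big1 // => b _; rewrite (negPf (nl b)).
Qed.

(* Subtracting from row [k] of [W] the largest multiple of row [l] that keeps it
   nonnegative creates a new zero, and can be compensated in [A]; geometrically,
   a vertex is pushed outwards along an edge until it hits the outer polygon. *)
Lemma nnfact_reduce a b q (A : 'M[R]_(a, q)) (W : 'M[R]_(q, b)) k l j0 :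
  nonneg_mx A -> nonneg_mx W -> k != l -> W l j0 != 0 ->
  (forall j, W l j != 0 -> W k j != 0) ->
  exists (A' : 'M[R]_(a, q)) (W' : 'M[R]_(q, b)),
  [/\ nonneg_mx A', nonneg_mx W', A *m W = A' *m W'
    & (\sum_i \sum_j (W' i j != 0%R) < \sum_i \sum_j (W i j != 0%R))%nat].
Proof.
move=> A0 W0 kl Wj0 supp.
have [j1 Wj1 minj] := @arg_minP _ _ _ j0 (fun j => W l j != 0)
                                (fun j => W k j / W l j) Wj0.
pose t := W k j1 / W l j1.
have Wlp j : W l j != 0 -> 0 < W l j by rewrite lt_def W0 andbT.
have t0 : 0 <= t by rewrite divr_ge0.
(* As the square vanishes, [1 + t *: delta_mx k l] and [1 - t *: delta_mx k l] are inverse to each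
   other; they are inserted between [A] and [W]. *)
have dd : delta_mx k l *m delta_mx k l = 0 :> 'M[R]_q.
  by rewrite mul_delta_mx_0 // eq_sym.
have dW i j : (delta_mx k l *m W) i j = if i == k then W l j else 0.
  rewrite mxE (bigD1 l) //= big1 ?addr0 ?mxE ?eqxx ?andbT.
    by case: ifP => _; rewrite ?mul1r ?mul0r.
  by move=> m ml; rewrite mxE (negPf ml) andbF mul0r.
have dA i m : (A *m delta_mx k l) i m = if m == l then A i k else 0.
  rewrite mxE (bigD1 k) //= big1 ?addr0 ?mxE ?eqxx ?andTb.
    by case: ifP => _; rewrite ?mulr1 ?mulr0.
  by move=> m' mk; rewrite mxE (negPf mk) mulr0.
pose W' := W - t *: (delta_mx k l *m W).
have W'E i j : W' i j = if i == k then W k j - t * W l j else W i j.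
  rewrite [LHS]mxE [fun_of_matrix (- _) i j]mxE [fun_of_matrix (t *: _) i j]mxE dW.
  by case: eqP => [->|_] //; rewrite mulr0 subr0.
exists (A + t *: (A *m delta_mx k l)), W'; split.
- move=> i m; rewrite [leRHS]mxE [fun_of_matrix (t *: _) i m]mxE dA.
  by rewrite addr_ge0 // mulr_ge0 //; case: ifP.
- move=> i j; rewrite W'E; case: ifP => // _; rewrite subr_ge0.
  have [->|Wlj] := eqVneq (W l j) 0; first by rewrite mulr0.
  by rewrite -ler_pdivlMr ?minj // Wlp.
- rewrite /W' mulmxBr !mulmxDl -!scalemxAl -!scalemxAr.
  rewrite -[A *m delta_mx k l *m (_ *m W)]mulmxA [delta_mx k l *m (_ *m W)]mulmxA dd.
  rewrite mul0mx mulmx0 !scaler0 addr0 mulmxA.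
  by rewrite addrK.
- have mono i j : ((W' i j != 0%R) <= (W i j != 0%R))%nat.
    rewrite W'E; case: (i =P k) => [->|_] //.
    have [Wkj|] := eqVneq (W k j) 0; last by move=> _; apply: leq_b1.
    have [->|Wlj] := eqVneq (W l j) 0; first by rewrite Wkj mulr0 subr0 eqxx.
    by have := supp j Wlj; rewrite Wkj eqxx.
  rewrite (bigD1 k) //= [ltnRHS](bigD1 k) //= -addSn leq_add //.
    rewrite (bigD1 j1) //= [ltnRHS](bigD1 j1) //= -addSn leq_add //.
      by rewrite W'E eqxx /t divfK // subrr eqxx (supp _ Wj1).
    by apply: leq_sum => j _.
  by apply: leq_sum => i _; apply: leq_sum => j _.
Qed.

(** Descent on the number of nonzero entries of [W]: [nnfact_reduce] applies as long as the support
    of some row contains that of another. The nonzero rows are assumed for all factorizations since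
    the descent changes the factors. *)
Lemma nnfact_antichain a b q (M : 'M[R]_(a, b)) :
  (forall (A : 'M[R]_(a, q)) (W : 'M[R]_(q, b)), M = A *m W ->
     forall k, exists j, W k j != 0) ->
  nnfact M q ->
  exists (A : 'M[R]_(a, q)) (W : 'M[R]_(q, b)),
  [/\ nonneg_mx A, nonneg_mx W, M = A *m W
    & forall k l, k != l -> exists j, W l j != 0 /\ W k j = 0].
Proof.
move=> Wn0 [A [W [A0 [W0 MAW]]]].
have [m] := ubnP (\sum_i \sum_j (W i j != 0%R))%nat.
elim: m => // m IH in A W A0 W0 MAW *; rewrite ltnS => le_m.
have [/forallP anti|] := boolP [forall k, forall l, (k != l) ==>
                          [exists j, (W l j != 0) && (W k j == 0)]].
  exists A, W; split=> // k l kl.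
  have /forallP/(_ l)/implyP/(_ kl)/existsP[j /andP[? /eqP ?]] := anti k.
  by exists j.
move=> /forallPn[k /forallPn[l]]; rewrite negb_imply => /andP[kl /existsPn supp].
have [j0 Wj0] := Wn0 _ _ MAW l.
have [|A' [W' [A'0 W'0 eAW lt_s]]] := @nnfact_reduce _ _ _ A W k l j0 A0 W0 kl Wj0.
  by move=> j Wlj; have := supp j; rewrite Wlj.
apply: (IH A' W') => //; first by rewrite -eAW.
exact: leq_trans lt_s le_m.
Qed.

End NonnegativeFactorizations.

(** * The point configuration and the triangles around it *)

Section CorePoints.
Local Open Scope ring_scope.
Variable F : realFieldType.

(** The centers have spacing [1 / (10 * n)] and the intervals have radius 2/3 of it: neighbours
    overlap but miss each other's center. The two end intervals are stretched to 1/4 and 3. *)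
Definition center (n i : nat) : F := 1 + i%:R / (10 * n%:R).
Definition lo (n i : nat) : F :=
  if i == 0%nat then 1 / 4 else 1 + (i%:R - 2 / 3) / (10 * n%:R).
Definition hi (n i : nat) : F :=
  if i.+1 == n then 3 else 1 + (i%:R + 2 / 3) / (10 * n%:R).

(* The indices from [n + 4] on all give the point [(10, 1, 10)]. *)
Definition point (n i : nat) : F * F * F :=
  if (i < n)%nat then
    (2 * lo n i * hi n i, 2, lo n i * hi n i + lo n i + hi n i + 3)
  else nth (10, 1, 10) [:: (1, 1, 1); (3, 1, 1); (2, 9, 18); (18, 9, 2)] (i - n).

Lemma ler_div10n n (x y : F) : (0 < n)%nat -> x <= y -> x / (10 * n%:R) <= y / (10 * n%:R).
Proof. by move=> n0 xy; rewrite ler_pM2r // invr_gt0 mulr_gt0 // ltr0n. Qed.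

Lemma ltr_div10n n (x y : F) : (0 < n)%nat -> x < y -> x / (10 * n%:R) < y / (10 * n%:R).
Proof. by move=> n0 xy; rewrite ltr_pM2r // invr_gt0 mulr_gt0 // ltr0n. Qed.

Lemma div10n n : (0 < n)%nat -> n%:R / (10 * n%:R) = 1 / 10 :> F.
Proof. by move=> n0; field; rewrite pnatr_eq0 -lt0n. Qed.

Lemma center_bounds n i : (i < n)%nat -> 1 <= center n i <= 11 / 10.
Proof.
move=> lt_in; have n0 : (0 < n)%nat by lia.
have h1 : 0 / (10 * n%:R) <= i%:R / (10 * n%:R) :> F by apply: ler_div10n; rewrite ?ler0n.
have h2 : i%:R / (10 * n%:R) <= n%:R / (10 * n%:R) :> F.
  by apply: ler_div10n; rewrite // ler_nat ltnW.
by move: h1 h2; rewrite /center mul0r div10n // => h1 h2; lra.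
Qed.

Lemma lo_bounds n i : (i < n)%nat -> 1 / 4 <= lo n i <= 11 / 10.
Proof.
move=> lt_in; have n0 : (0 < n)%nat by lia.
rewrite /lo; case: eqP => [_|i0]; first by lra.
have i1 : 1 <= i%:R :> F by rewrite ler1n; lia.
have h1 : 0 / (10 * n%:R) <= (i%:R - 2/3) / (10 * n%:R) :> F by apply: ler_div10n => //; lra.
have h2 : (i%:R - 2/3) / (10 * n%:R) <= n%:R / (10 * n%:R) :> F.
  apply: ler_div10n => //; have : i%:R <= n%:R :> F by rewrite ler_nat ltnW.
  by lra.
by move: h1 h2; rewrite mul0r div10n // => h1 h2; lra.
Qed.

Lemma hi_bounds n i : (i < n)%nat -> 1 <= hi n i <= 3.
Proof.
move=> lt_in; have n0 : (0 < n)%nat by lia.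
rewrite /hi; case: eqP => [_|i0]; first by lra.
have i1 : 0 <= i%:R :> F by rewrite ler0n.
have h1 : 0 / (10 * n%:R) <= (i%:R + 2/3) / (10 * n%:R) :> F by apply: ler_div10n => //; lra.
have h2 : (i%:R + 2/3) / (10 * n%:R) <= n%:R / (10 * n%:R) :> F.
  apply: ler_div10n => //; have : i.+1%:R <= n%:R :> F by rewrite ler_nat.
  by rewrite -natr1; lra.
by move: h1 h2; rewrite mul0r div10n // => h1 h2; lra.
Qed.

(** The first [i] with [U < hi n i] works: for [i > 0], minimality gives [hi n i.-1 <= U], and
    consecutive intervals overlap. *)
Lemma intervals_cover n (U : F) : (0 < n)%nat -> 1 / 4 < U < 3 ->
  exists2 i, (i < n)%nat & lo n i < U < hi n i.
Proof.
move=> n0 hU.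
have ex : exists i, (i < n)%nat && (U < hi n i).
  by exists n.-1; rewrite ltn_predL n0 /= /hi prednK // eqxx; lra.
case: (ex_minnP ex) => i /andP[lt_in Uhi] mini; exists i => //.
rewrite Uhi andbT /lo; case: eqP => [_|i0]; first by lra.
have hle : hi n i.-1 <= U.
  rewrite leNgt; apply/negP => hlt.
  by have := mini i.-1; rewrite hlt andbT => /(_ ltac:(lia)); lia.
apply: lt_le_trans hle; rewrite /hi; case: eqP => [e|_]; first by lia.
rewrite ltrD2l ltr_div10n //.
have -> : i%:R = i.-1%:R + 1 :> F by rewrite natr1 prednK //; lia.
by lra.
Qed.

Lemma center_outside n i j : (i < n)%nat -> (j < n)%nat -> i != j ->
  0 <= (center n j - lo n i) * (center n j - hi n i).
Proof.
move=> lt_in lt_jn nij; have n0 : (0 < n)%nat by lia.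
have hc := center_bounds _ _ lt_jn; have hl := lo_bounds _ _ lt_in.
have hh := hi_bounds _ _ lt_in.
have [lt_ij|le_ji] := ltnP i j.
  have h : hi n i <= center n j.
    rewrite /hi /center; case: eqP => [e|_]; first by lia.
    rewrite lerD2l ler_div10n //.
    have : i.+1%:R <= j%:R :> F by rewrite ler_nat.
    by rewrite -natr1; lra.
  apply: mulr_ge0; last by lra.
  apply: le_trans (_ : center n j - hi n i <= _); first by lra.
  rewrite lerD2l lerN2 /lo /hi.
  have h1 : 0 <= (i%:R + 2/3) / (10 * n%:R) :> F.
    apply: divr_ge0; last by rewrite mulr_ge0 ?ler0n.
    by have := ler0n F i; lra.
  case: eqP => [_|i0]; case: eqP => [e|_]; try lia; first by lra.
  by rewrite lerD2l ler_div10n //; lra.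
have {le_ji nij} lt_ji : (j < i)%nat by lia.
have h : center n j <= lo n i.
  rewrite /lo /center; case: eqP => [e|_]; first by lia.
  rewrite lerD2l ler_div10n //.
  have : j.+1%:R <= i%:R :> F by rewrite ler_nat.
  by rewrite -natr1; lra.
apply: mulr_le0; first by lra.
suff : lo n i <= hi n i by lra.
rewrite /lo /hi; case: eqP => [e|_]; first by lia.
case: eqP => [e|_]; last by rewrite lerD2l ler_div10n //; lra.
by move: hl; rewrite /lo; case: eqP => [|_]; [lia | lra].
Qed.

Lemma point_coef_ge0 n i j e : (j < n)%nat -> i != j ->
  0 <= coef _ (center n j) (point n i) e.
Proof.
move=> lt_jn nij; have hc := center_bounds _ _ lt_jn.
rewrite /point; case: ltnP => [lt_in|_].
  have hl := lo_bounds _ _ lt_in.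
  by apply: coef_interval_ge0; rewrite ?hi_bounds ?center_outside //; lra.
(* The five auxiliary points lie in [T(U)] for every [U] between 1 and 11/10. *)
move: hc; move: (center n j) => U hU; have U0 : 0 < U by lra.
case: (i - n)%nat => [|[|[|[|m]]]] /=; rewrite ?nth_nil; apply: coef_ge0 => //; nra.
Qed.

(** The vertices lie on consecutive sides, starting with side [s]. For [s = 0] (left, bottom, right)
    some interval contains the parameter of the triangle; otherwise a cyclic shift of the
    coordinates leads to one of the [no_tri] lemmas. *)
Lemma no_nested_triangle n (a b c : nat -> F) (l m k : 'I_(3 * n) -> F) s :
  (3 <= n)%nat ->
  (forall j, 0 <= a j) -> (forall j, 0 <= b j) -> (forall j, 0 <= c j) ->
  (forall i, 0 <= l i) -> (forall i, 0 <= m i) -> (forall i, 0 <= k i) ->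
  a 0%nat + a 2%nat = a 1%nat + a 3%nat ->
  b 0%nat + b 2%nat = b 1%nat + b 3%nat ->
  c 0%nat + c 2%nat = c 1%nat + c 3%nat ->
  (forall (i : 'I_(3 * n)) j, (j < 4)%nat ->
     slack _ (point n i) j = l i * a j + m i * b j + k i * c j) ->
  (s < 4)%nat -> a s = 0 -> b (s.+1 %% 4)%nat = 0 -> c (s.+2 %% 4)%nat = 0 -> False.
Proof.
move=> n3 a0 b0 c0 l0 m0 k0 ha hb hc E.
have n0 : (0 < n)%nat by lia.
(* All [n + 5] distinguished points fit into [3 * n] rows because [3 <= n]. *)
have idx i : (i < n + 5)%nat -> {i' : 'I_(3 * n) | i' = i :> nat}.
  move=> lt_i; have lt_i3 : (i < 3 * n)%nat by lia.
  by exists (Ordinal lt_i3).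
have pt i : point n (n + i) = nth (10, 1, 10) [:: (1, 1, 1); (3, 1, 1); (2, 9, 18); (18, 9, 2)] i.
  by rewrite /point ltnNge leq_addr addKn.
have [q3 e3] := idx (n + 0)%nat ltac:(lia).
have [q2 e2] := idx (n + 1)%nat ltac:(lia).
have [kL eL] := idx (n + 2)%nat ltac:(lia).
have [kR eR] := idx (n + 3)%nat ltac:(lia).
have [kB eB] := idx (n + 4)%nat ltac:(lia).
have P3 : point n q3 = (1, 1, 1) by rewrite e3 pt.
have P2 : point n q2 = (3, 1, 1) by rewrite e2 pt.
have PL : point n kL = (2, 9, 18) by rewrite eL pt.
have PR : point n kR = (18, 9, 2) by rewrite eR pt.
have PB : point n kB = (10, 1, 10) by rewrite eB pt.
case: s => [|[|[|[|s]]]] //= _ as0 bs0 cs0.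
- have [al [be [ga [hal hbe hga T]]]] := @in_tri_param _ (a 0%nat) (a 1%nat) (a 2%nat)
    (a 3%nat) (b 0%nat) (b 1%nat) (b 2%nat) (b 3%nat) (c 0%nat) (c 1%nat) (c 2%nat)
    (c 3%nat) as0 bs0 cs0 ltac:(done) ltac:(done) ltac:(done) ltac:(done) ltac:(done)
    ltac:(done) ltac:(done) ltac:(done) ltac:(done) ltac:(lra) ltac:(lra) ltac:(lra).
  have T' (i : 'I_(3 * n)) x y z : point n i = (x, y, z) -> in_tri _ al be ga x y z.
    move=> Pi; apply: (T (l i) (m i) (k i)) => //; rewrite -E // Pi /=; lra.
  have [hal' hbe'] := tri_LBR_bounds _ _ _ _ hal hbe hga (T' _ _ _ _ PL)
                        (T' _ _ _ _ PR) (T' _ _ _ _ PB).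
  have al0 : 0 < al by lra.
  (* Solves [al = 2 / (U + 3)], so that [T(U)] has the same left vertex. *)
  pose U := 2 / al - 3.
  have hU : 1 / 4 < U < 3.
    by rewrite /U ltrBrDr ltrBlDr ltr_pdivlMr // ltr_pdivrMr //; lra.
  have [i lt_in /andP[loU Uhi]] := intervals_cover n U n0 hU.
  have [p ep] := idx i (ltn_addr 5 lt_in).
  have Pp : point n p = (2 * lo n i * hi n i, 2, lo n i * hi n i + lo n i + hi n i + 3).
    by rewrite /point ep lt_in.
  have hl := lo_bounds _ _ lt_in.
  apply: (tri_LBR_quadratic _ al be ga U (lo n i) (hi n i)) (T' _ _ _ _ P3)
    (T' _ _ _ _ P2) (T' _ _ _ _ Pp) => //; try lra.
  by rewrite /U subrK mulrC divfK // gt_eqF.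
- have [al [be [ga [hal hbe hga T]]]] := @in_tri_param _ (a 1%nat) (a 2%nat) (a 3%nat)
    (a 0%nat) (b 1%nat) (b 2%nat) (b 3%nat) (b 0%nat) (c 1%nat) (c 2%nat) (c 3%nat)
    (c 0%nat) as0 bs0 cs0 ltac:(done) ltac:(done) ltac:(done) ltac:(done) ltac:(done)
    ltac:(done) ltac:(done) ltac:(done) ltac:(done) ltac:(lra) ltac:(lra) ltac:(lra).
  apply: (no_tri_BRT _ al be ga) => //.
  + by apply: (T (l kL) (m kL) (k kL)) => //; rewrite -E // PL /=; lra.
  + by apply: (T (l kR) (m kR) (k kR)) => //; rewrite -E // PR /=; lra.
  + by apply: (T (l kB) (m kB) (k kB)) => //; rewrite -E // PB /=; lra.
- have [al [be [ga [hal hbe hga T]]]] := @in_tri_param _ (a 2%nat) (a 3%nat) (a 0%nat)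
    (a 1%nat) (b 2%nat) (b 3%nat) (b 0%nat) (b 1%nat) (c 2%nat) (c 3%nat) (c 0%nat)
    (c 1%nat) as0 bs0 cs0 ltac:(done) ltac:(done) ltac:(done) ltac:(done) ltac:(done)
    ltac:(done) ltac:(done) ltac:(done) ltac:(done) ltac:(lra) ltac:(lra) ltac:(lra).
  apply: (no_tri_RTL _ al be ga) => //.
  + by apply: (T (l kL) (m kL) (k kL)) => //; rewrite -E // PL /=; lra.
  + by apply: (T (l kR) (m kR) (k kR)) => //; rewrite -E // PR /=; lra.
  + by apply: (T (l kB) (m kB) (k kB)) => //; rewrite -E // PB /=; lra.
- have [al [be [ga [hal hbe hga T]]]] := @in_tri_param _ (a 3%nat) (a 0%nat) (a 1%nat)
    (a 2%nat) (b 3%nat) (b 0%nat) (b 1%nat) (b 2%nat) (c 3%nat) (c 0%nat) (c 1%nat)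
    (c 2%nat) as0 bs0 cs0 ltac:(done) ltac:(done) ltac:(done) ltac:(done) ltac:(done)
    ltac:(done) ltac:(done) ltac:(done) ltac:(done) ltac:(lra) ltac:(lra) ltac:(lra).
  apply: (no_tri_TLB _ al be ga) => //.
  + by apply: (T (l kL) (m kL) (k kL)) => //; rewrite -E // PL /=; lra.
  + by apply: (T (l kR) (m kR) (k kR)) => //; rewrite -E // PR /=; lra.
  + by apply: (T (l kB) (m kB) (k kB)) => //; rewrite -E // PB /=; lra.
Qed.

End CorePoints.

(** * Nonnegative rank of a single block *)

Section CoreMatrix.
Local Open Scope ring_scope.

Definition core n : 'M[R]_(3 * n, 4) := \matrix_(i, j) slack _ (point _ n i) j.

Lemma sum3 (f : 'I_3 -> R) :
  \sum_k f k = f (inord 0) + f (inord 1) + f (inord 2).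
Proof.
rewrite !big_ord_recl big_ord0 addr0 addrA.
by congr (f _ + f _ + f _); apply/val_inj; rewrite /= inordK.
Qed.

Lemma sum4 (f : 'I_4 -> R) :
  \sum_k f k = f (inord 0) + f (inord 1) + f (inord 2) + f (inord 3).
Proof.
rewrite !big_ord_recl big_ord0 addr0 !addrA.
by congr (f _ + f _ + f _ + f _); apply/val_inj; rewrite /= inordK.
Qed.

Definition perms3 : seq (nat * nat * nat) :=
  [:: (0, 1, 2); (0, 2, 1); (1, 0, 2); (1, 2, 0); (2, 0, 1); (2, 1, 0)]%nat.

Definition consecutive_zeros (z : nat -> nat -> bool) (t : nat * nat * nat) :=
  let: (a, b, c) := t in
  has (fun s => [&& z a s, z b (s.+1 %% 4)%nat & z c (s.+2 %% 4)%nat]) (iota 0 4).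

Definition strict_zero (z : nat -> nat -> bool) (k l : nat) :=
  has (fun j => z k j && ~~ z l j) (iota 0 4).

(** The possible sets of sides through a point of the square: none in the interior, one on a side,
    two adjacent ones at a corner. *)
Definition zero_patterns : seq (seq bool) :=
  [:: [:: false; false; false; false];
      [:: true; false; false; false]; [:: false; true; false; false];
      [:: false; false; true; false]; [:: false; false; false; true];
      [:: true; true; false; false]; [:: false; true; true; false];
      [:: false; false; true; true]; [:: true; false; false; true]].

Definition pattern_check (q0 q1 q2 : seq bool) :=
  let z k j := nth false (nth [::] [:: q0; q1; q2] k) j in
  [&& strict_zero z 0 1, strict_zero z 0 2, strict_zero z 1 0,
      strict_zero z 1 2, strict_zero z 2 0 & strict_zero z 2 1]
  ==> has (consecutive_zeros z) perms3.

Lemma pattern_checkT : all (fun q0 => all (fun q1 => all (pattern_check q0 q1)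
  zero_patterns) zero_patterns) zero_patterns.
Proof. by vm_compute. Qed.

(** Each of the three rows has one of nine patterns, and [pattern_checkT] goes through all
    triples. *)
Lemma antichain_consecutive_zeros (z : nat -> nat -> bool) :
  (forall k, (k < 3)%nat -> ~~ (z k 0%nat && z k 2%nat) && ~~ (z k 1%nat && z k 3%nat)) ->
  (forall k l, (k < 3)%nat -> (l < 3)%nat -> k != l -> strict_zero z k l) ->
  has (consecutive_zeros z) perms3.
Proof.
move=> zo zs; pose q k := [:: z k 0; z k 1; z k 2; z k 3]%nat.
have qin k : (k < 3)%nat -> q k \in zero_patterns.
  move=> /zo; rewrite /q.
  by case: (z k 0%nat); case: (z k 1%nat); case: (z k 2%nat); case: (z k 3%nat).
have /allP/(_ _ (qin 0%nat isT))/allP/(_ _ (qin 1%nat isT)) := pattern_checkT.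
move=> /allP/(_ _ (qin 2%nat isT))/implyP; apply.
apply/and5P; split; last (apply/andP; split);
  [exact: (zs 0 1)%nat | exact: (zs 0 2)%nat | exact: (zs 1 0)%nat
  |exact: (zs 1 2)%nat | exact: (zs 2 0)%nat | exact: (zs 2 1)%nat].
Qed.

(** The differences [(3, 1, 1) - (1, 1, 1) = 2 (1, 0, 0)] and
    [(10, 1, 10) - (1, 1, 1) = 9 (1, 0, 1)] yield the three unit vectors. The same combinations of
    rows of [A] form [G], so [G] kills whatever [A] kills. *)
Lemma core_factor_rank n (A : 'M[R]_(3 * n, 3)) (W : 'M[R]_(3, 4)) :
  (3 <= n)%nat -> core n = A *m W ->
  exists2 G : 'M[R]_3, G *m W = \matrix_(i < 3, j < 4)
    slack _ (nth (0, 0, 1) [:: (1, 0, 0); (0, 1, 0)] i) j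
  & (forall d : 'cV[R]_3, A *m d = 0 -> G *m d = 0).
Proof.
move=> n3 E.
have i3P : (n + 0 < 3 * n)%nat by lia.
have i2P : (n + 1 < 3 * n)%nat by lia.
have iBP : (n + 4 < 3 * n)%nat by lia.
pose i3 := Ordinal i3P; pose i2 := Ordinal i2P; pose iB := Ordinal iBP.
pose gx := 2^-1 *: (row i2 A - row i3 A).
pose gz := 9^-1 *: (row iB A - row i3 A - 9 *: gx).
pose gy := row i3 A - gx - gz.
have pt i : point R n (n + i) =
    nth (10, 1, 10) [:: (1, 1, 1); (3, 1, 1); (2, 9, 18); (18, 9, 2)] i.
  by rewrite /point ltnNge leq_addr addKn.
have rE (i : 'I_(3 * n)) v : point R n i = v -> row i A *m W = \row_j slack _ v j.
  by move=> <-; rewrite -row_mul -E; apply/rowP => j; rewrite !mxE.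
have r3 := rE i3 _ (pt 0%nat); have r2 := rE i2 _ (pt 1%nat).
have rB := rE iB _ (pt 4%nat).
exists (\matrix_(e < 3) nth gz [:: gx; gy] e).
  apply/row_matrixP => e; rewrite row_mul rowK.
  have xE : gx *m W = \row_j slack _ (1, 0, 0) j.
    rewrite -scalemxAl mulmxBl r3 r2; apply/rowP => j; rewrite !mxE.
    by case: j => [[|[|[|[|j]]]] ?] //=; lra.
  have zE : gz *m W = \row_j slack _ (0, 0, 1) j.
    rewrite -scalemxAl !mulmxBl -scalemxAl xE r3 rB; apply/rowP => j; rewrite !mxE.
    by case: j => [[|[|[|[|j]]]] ?] //=; lra.
  have yE : gy *m W = \row_j slack _ (0, 1, 0) j.
    rewrite !mulmxBl xE zE r3; apply/rowP => j; rewrite !mxE.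
    by case: j => [[|[|[|[|j]]]] ?] //=; lra.
  by case: e => [[|[|[|e]]] ?] //=; rewrite ?xE ?yE ?zE; apply/rowP => j; rewrite !mxE.
move=> d Ad0.
have rd i : row i A *m d = 0 by rewrite -row_mul Ad0 row0.
have xd : gx *m d = 0 by rewrite -scalemxAl mulmxBl !rd subrr scaler0.
have zd : gz *m d = 0 by rewrite -scalemxAl !mulmxBl -scalemxAl xd !rd scaler0 !subr0 scaler0.
have yd : gy *m d = 0 by rewrite !mulmxBl rd xd zd !subr0.
apply/row_matrixP => e; rewrite row_mul rowK row0.
by case: e => [[|[|[|e]]] ?].
Qed.

(** The first three columns of [W] form a matrix with inverse [G], so no row of [W] is zero. The
    relation between the coordinates says that [h] is killed by [core n]; then [A], hence [G], kills
    [W *m h], which is therefore zero. *)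
Lemma core_factor_square n (A : 'M[R]_(3 * n, 3)) (W : 'M[R]_(3, 4)) :
  (3 <= n)%nat -> core n = A *m W ->
  (forall k, exists j, W k j != 0) /\
  (forall k, W k (inord 0) + W k (inord 2) = W k (inord 1) + W k (inord 3)).
Proof.
move=> n3 E; have [G GW Gd] := core_factor_rank _ _ _ n3 E.
pose P : 'M[R]_(4, 3) := \matrix_(i, j) (i == j :> nat)%:R.
have GWP : G *m (W *m P) = 1%:M.
  rewrite mulmxA GW; apply/matrixP => i j; rewrite !mxE !big_ord_recl big_ord0 !mxE /=.
  by case: i => [[|[|[|i]]] ?] //; case: j => [[|[|[|j]]] ?] //=; lra.
have WPG := mulmx1C GWP.
split=> k.
  apply/existsP; apply: contraT => /existsPn Wk0.
  have /matrixP/(_ k k) := WPG; rewrite -mulmxA mxE big1; last first.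
    by move=> j _; have := Wk0 j; rewrite negbK => /eqP->; rewrite mul0r.
  by rewrite mxE eqxx => /esym/eqP; rewrite oner_eq0.
pose h : 'cV[R]_4 := \col_j (-1) ^+ j.
have Ah : A *m (W *m h) = 0.
  rewrite mulmxA -E; apply/colP => i; rewrite mxE !big_ord_recl big_ord0 !mxE /=.
  by case: (point _ _ _) => [[x y] z] /=; rewrite /bump /=; ring.
have Wh : W *m h = 0 by rewrite -[W *m h]mul1mx -WPG -mulmxA Gd // mulmx0.
have /colP/(_ k) := Wh; rewrite !mxE sum4 !mxE !inordK // => e.
by lra.
Qed.

Lemma core_nnfact3 n : (3 <= n)%nat -> ~ nnfact (core n) 3.
Proof.
move=> n3 /nnfact_antichain[].
  by move=> A W E; have [] := core_factor_square _ _ _ n3 E.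
move=> A [W [A0 W0 E anti]].
have [Wn0 Wsq] := core_factor_square _ _ _ n3 E.
pose w k j := W (inord k) (inord j); pose z k j := w k j == 0.
have inord_neq k l : (k < 3)%nat -> (l < 3)%nat -> k != l -> inord k != inord l :> 'I_3.
  by move=> k3 l3; apply: contra => /eqP/(congr1 val); rewrite /= !inordK // => ->.
have sq k : w k 0%nat + w k 2%nat = w k 1%nat + w k 3%nat by exact: Wsq.
have wn0 k : ~~ [&& z k 0%nat, z k 1%nat, z k 2%nat & z k 3%nat].
  have [j Wj] := Wn0 (inord k); apply: contra Wj => /and4P[/eqP z0 /eqP z1 /eqP z2 /eqP z3].
  rewrite -[j]inord_val; case: j => [[|[|[|[|j]]]] ?] //=; apply/eqP => //.
have /hasP[[[k0 k1] k2] kin /hasP[s]] : has (consecutive_zeros z) perms3.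
  apply: antichain_consecutive_zeros => [k _|k l k3 l3 kl].
    have w0 j : 0 <= w k j by exact: W0.
    have := w0 0%nat; have := w0 1%nat; have := w0 2%nat; have := w0 3%nat.
    have := sq k; have := wn0 k; rewrite /z => nz e p3 p2 p1 p0.
    apply/andP; split; apply: contra nz => /andP[/eqP e1 /eqP e2];
      by apply/and4P; split; apply/eqP; lra.
  have [j [Wlj Wkj]] := anti _ _ (inord_neq _ _ k3 l3 kl).
  apply/hasP; exists (j : nat); first by rewrite mem_iota ltn_ord.
  by rewrite /z /w inord_val Wkj eqxx Wlj.
rewrite mem_iota => /= s4 /and3P[/eqP zs0 /eqP zs1 /eqP zs2].
apply: (@no_nested_triangle _ n (w k0) (w k1) (w k2) (fun i => A i (inord k0))
  (fun i => A i (inord k1)) (fun i => A i (inord k2)) s n3) => //;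
  try by move=> ?; exact: W0.
move=> i j j4.
have := congr1 (fun M : 'M_(_, _) => M i (inord j)) E; rewrite !mxE sum3 inordK // => ->.
move: kin; rewrite !inE => /or4P[|||/or3P[||]] /eqP[-> -> ->]; rewrite /w; ring.
Qed.

Lemma core_nnfact n k : (3 <= n)%nat -> nnfact (core n) k -> (4 <= k)%nat.
Proof.
move=> n3 Nk; rewrite leqNgt; apply/negP => k3; apply: (core_nnfact3 _ n3).
exact: nnfact_leq Nk.
Qed.

End CoreMatrix.

(** * The block diagonal matrix and its row submatrices *)

Section BlockMatrix.
Local Open Scope ring_scope.

(** Since [slack] is 0 from index 4 on, each diagonal block is [core n] padded with zero columns to
    a square. *)
Definition block_matrix (r n : nat) : 'M[R]_(3 * r * n) :=
  \matrix_(i, j) if (i %/ (3 * n) == j %/ (3 * n))%nat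
                 then slack _ (point R n (i %% (3 * n))) (j %% (3 * n)) else 0.

Lemma block_index_bound (r n b i : nat) : (b < r)%nat -> (i < 3 * n)%nat ->
  (b * (3 * n) + i < 3 * r * n)%nat.
Proof. by nia. Qed.

Lemma slack_point_ge0 n i j : 0 <= slack _ (point R n i) j.
Proof.
rewrite /point; case: ltnP => [lt_in|_].
  have := lo_bounds R _ _ lt_in; have := hi_bounds R _ _ lt_in.
  move: (lo _ _ _) (hi _ _ _) => A B hB hA.
  have AB0 : 0 <= A * B by rewrite mulr_ge0 //; lra.
  by case: j => [|[|[|[|j]]]] /=; rewrite ?nth_nil; lra.
by case: (i - n)%nat => [|[|[|[|m]]]] /=; rewrite ?nth_nil;
   case: j => [|[|[|[|j]]]] /=; rewrite ?nth_nil; lra.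
Qed.

Lemma block_matrix_ge0 r n : nonneg_mx (block_matrix r n).
Proof. by move=> i j; rewrite mxE; case: ifP => // _; apply: slack_point_ge0. Qed.

Lemma block_matrix_nnfact r n k : (3 <= n)%nat ->
  nnfact (block_matrix r n) k -> (4 * r <= k)%nat.
Proof.
move=> n3; have le4 : (4 <= 3 * n)%nat by lia.
pose f (b : 'I_r) (i : 'I_(3 * n)) :=
  Ordinal (block_index_bound _ _ _ _ (ltn_ord b) (ltn_ord i)).
apply: (@nnfact_blocks _ _ _ _ r k 4 _ (core n) f
          (fun b j => f b (widen_ord le4 j))) => [b b' i j|k']; last exact: core_nnfact.
have n0 : (0 < 3 * n)%nat by lia.
have j4 : (j < 3 * n)%nat by apply: leq_trans (ltn_ord j) le4.
by rewrite !mxE /= !divnMDl // !divn_small // !addn0 !modnMDl !modn_small.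
Qed.

(* Fewer than [n] rows miss some of the [n] residues [c < n] modulo [3 * n], and the
   triangle with parameter [center n c] then serves all blocks at once. *)
Lemma block_matrix_rows r n (S : {set 'I_(3 * r * n)}) : (#|S| < n)%nat ->
  nnfact (rows_submx (block_matrix r n) S) (3 * r).
Proof.
move=> ltSn.
have [c cn cS] : exists2 c, (c < n)%nat & forall i, i \in S -> (i %% (3 * n))%nat != c.
  have [/hasP[c]|/hasPn allS] := boolP (has
      (fun c => c \notin [seq (nat_of_ord i %% (3 * n))%nat | i <- enum S]) (iota 0 n)).
    rewrite mem_iota => /= cn cS; exists c => // i iS; apply: contra cS => /eqP <-.
    by apply/mapP; exists i; rewrite ?mem_enum.
  have := uniq_leq_size (iota_uniq 0 n) (fun c h => negbNE (allS c h)).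
  by rewrite size_iota size_map -cardE leqNgt ltSn.
have /andP[c1 _] := center_bounds R _ _ cn; have U0 := lt_le_trans ltr01 c1.
apply: (@nnfact_leq _ _ _ #|[set: 'I_r * 'I_3]|).
  by rewrite cardsT card_prod !card_ord mulnC.
pose A (i : 'I_#|S|) (t : 'I_r * 'I_3) :=
  if ((enum_val i : 'I_(3 * r * n)) %/ (3 * n))%nat == t.1 :> nat then
    coef R (center R n c) (point R n ((enum_val i : 'I_(3 * r * n)) %% (3 * n))) t.2 else 0.
pose W (t : 'I_r * 'I_3) (j : 'I_(3 * r * n)) :=
  if (j %/ (3 * n))%nat == t.1 :> nat then
    slack R (vertex R (center R n c) t.2) (j %% (3 * n)) else 0.
apply: (@nnfact_set _ _ _ _ _ A W).
- move=> i t; rewrite /A; case: ifP => // _; apply: point_coef_ge0 => //.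
  exact/cS/enum_valP.
- by move=> t j; rewrite /W; case: ifP => // _; apply: vertex_ge0.
move=> i j; rewrite !mxE.
rewrite (eq_bigl xpredT) => [|t]; last by rewrite inE.
rewrite -(pair_bigA _ (fun b e => A i (b, e) * W (b, e) j)) /= /A /W /=.
have brP : (enum_val i %/ (3 * n) < r)%nat.
  rewrite ltn_divLR; last by lia.
  by have := ltn_ord (enum_val i); lia.
rewrite (bigD1 (Ordinal brP)) //= [X in _ + X]big1 => [|b /negPf nb]; last first.
  rewrite big1 // => e _; rewrite ifF ?mul0r //.
  by apply: contraFF nb => /eqP e'; apply/eqP/val_inj.
rewrite addr0 eqxx eq_sym; case: ifP => _; first exact: slack_vertex.
by rewrite big1 // => e _; rewrite mulr0.
Qed.

Lemma id_ge0 m : nonneg_mx (1%:M : 'M[R]_m).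
Proof. by move=> i j; rewrite mxE; case: eqP. Qed.

Lemma id_nnfact m k : nnfact (1%:M : 'M[R]_m) k -> (m <= k)%nat.
Proof.
move=> [A [W [_ [_ E]]]]; rewrite -[m in leqLHS](mxrank1 R) E.
exact: leq_trans (mxrankM_maxl _ _) (rank_leq_col _).
Qed.

End BlockMatrix.

Theorem mainTheorem2 (r n : nat) (hn : leq 2 n) :
  exists M : 'M[R]_(3 * r * n, 3 * r * n),
    nonneg_mx M /\
    (forall k, nnrank M k -> leq (4 * r) k) /\
    (forall S : {set 'I_(3 * r * n)}, #|S| < n ->
       forall k, nnrank (rows_submx M S) k -> leq k (3 * r)).
Proof.
have [n3|n2] := leqP 3 n.
  exists (block_matrix r n); split; first exact: block_matrix_ge0.
  split=> [k [Mk _]|S ltSn k [_ kmin]]; first exact: block_matrix_nnfact Mk.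
  exact/kmin/block_matrix_rows.
exists (scalar_mx (GRing.one _)); split; first exact: id_ge0.
split=> [k [Mk _]|S ltSn k [_ kmin]].
  by have := id_nnfact _ _ Mk; nia.
have kS : (k <= #|S|)%nat by apply/kmin/nnfact_nrows => i j; rewrite mxE; apply: id_ge0.
(* At most one row is selected, which suffices for [r > 0]; for [r = 0], [max_card] shows that there
   is none. *)
have := max_card S; rewrite card_ord; nia.
Qed.
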